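(* Let $\mathsf{M}$ be a matroid on $E$ without loops or coloops. The square conormal fan $\Sigma_{-\mathsf{M},\mathsf{M}^\perp}$ is the induced subfan of the bipermutohedral fan $\Sigma_{E,E}$ whose rays are indexed by the square biflats $F\subseteq G$ of $\mathsf{M}$ (the ray of $F\subseteq G$ being spanned by $e_{E\setminus F}+f_G$). In particular, $\Sigma_{-\mathsf{M},\mathsf{M}^\perp}$ is smooth.
   Context: $E$ is a finite set, $N_E=\mathbb{R}^E/\mathbb{R}e_E$ with lattice $\mathbb{Z}^E/\mathbb{Z}e_E$, where $e_S=\sum_{i\in S}e_i$. $N_{E,E}=N_E\oplus N_E$; indicator vectors in the two summands are written $e_S$ and $f_S$. A smooth fan is a simplicial unimodular one. An induced subfan is the subfan of all cones whose rays all lie in a given set of rays. For a loopless matroid $\mathsf{M}$ on $E$, the Bergman fan $\Sigma_{\mathsf{M}}$ in $N_E$ has cones spanned by $e_{F_1},\dots,e_{F_k}$ for chains $\emptyset\subsetneq F_1\subsetneq\cdots\subsetneq F_k\subsetneq E$ of flats of $\mathsf{M}$. $\mathsf{M}^\perp$ is the dual matroid and $\mathcal{L}_{\mathsf{M}}$ the lattice of flats. A bisubset $S|T$ is a pair of nonempty subsets of $E$ with $S\cup T=E$ and $S\cap T\ne E$. The bipermutohedral fan $\Sigma_{E,E}$ in $N_{E,E}$ is the complete smooth fan whose cones are spanned by the vectors $e_{S_i}+f_{T_i}$, $1\le i\le k$, where $S_i|T_i$ are bisubsets with $S_1\subseteq\cdots\subseteq S_k$, $T_1\supseteq\cdots\supseteq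 T_k$ and $\bigcup_i(S_i\cap T_i)\ne E$. For $\mathsf{M}$ without loops or coloops, the square conormal fan is the cone-wise intersection of fans $\Sigma_{-\mathsf{M},\mathsf{M}^\perp}=((-\Sigma_{\mathsf{M}})\times\Sigma_{\mathsf{M}^\perp})\cap\Sigma_{E,E}$. A square biflat $F\subseteq G$ of $\mathsf{M}$ is a pair of flats $F\in\mathcal{L}_{\mathsf{M}}$, $G\in\mathcal{L}_{\mathsf{M}^\perp}$ such that $(E\setminus F)|G$ is a bisubset; equivalently $F\subseteq G$, $F\ne E$, $G\neq\emptyset$, and $(F,G)\ne(\emptyset,E)$. *)

(* Defs.v *)
From HB Require Import structures.
From mathcomp Require Import all_boot all_order all_algebra.
From mathcomp Require Import all_classical reals.

Set Implicit Arguments.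
Unset Strict Implicit.
Unset Printing Implicit Defensive.

Import Order.TTheory GRing.Theory Num.Theory.

Local Open Scope ring_scope.
Local Open Scope classical_set_scope.
Local Open Scope quotient_scope.

Section Matroid.
Variable E : finType.

Record matroid := Matroid {
  bases : {set {set E}};
  bases_neq0 : bases != finset.set0;
  bases_exchange : forall B1 B2 x,
    B1 \in bases -> B2 \in bases -> x \in B1 :\: B2 ->
    exists2 y, y \in B2 :\: B1 & y |: (B1 :\ x) \in bases }.

Implicit Type M : matroid.

Definition mrank M (A : {set E}) : nat := \max_(B in bases M) #|A :&: B|.

Definition flat M (F : {set E}) : bool :=
  [forall x, (x \notin F) ==> (mrank M F < mrank M (x |: F))%N].

Definition loop M (x : E) : bool :=
  [forall (B : {set E} | B \in bases M), x \notin B].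

Definition coloop M (x : E) : bool :=
  [forall (B : {set E} | B \in bases M), x \in B].

Lemma basis_subset_eq M (A B : {set E}) :
  A \in bases M -> B \in bases M -> A \subset B -> A = B.
Proof.
move=> hA hB sAB; apply/eqP; rewrite finset.eqEsubset sAB /=.
apply/fintype.subsetP => x xB; apply: contraT => xA.
have xD : x \in B :\: A by rewrite finset.in_setD xA xB.
have [y] := bases_exchange hB hA xD.
rewrite finset.in_setD => /andP[yB yA].
by rewrite (fintype.subsetP sAB _ yA) in yB.
Qed.

Lemma bases_exchange_dual M (B1 B2 : {set E}) x :
  B1 \in bases M -> B2 \in bases M -> x \in B2 :\: B1 ->
  exists2 y, y \in B1 :\: B2 & x |: (B1 :\ y) \in bases M.
Proof.
move=> hB1 hB2; rewrite finset.in_setD => /andP[xB1 xB2].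
pose good (B : {set E}) := (B \in bases M) && (x |: (B1 :&: B2) \subset B).
have good2 : good B2 by rewrite /good hB2 finset.subUset finset.sub1set xB2 finset.subsetIr.
have [B /andP[hB sB] minB] := arg_minnP (fun B => #|B :\: (x |: B1)|) good2.
have BB1 : B \subset x |: B1.
  apply/fintype.subsetP => z zB; apply: contraT => zN.
  have [zx zB1] : z != x /\ z \notin B1.
    by move: zN; rewrite !inE negb_or => /andP.
  have zD : z \in B :\: B1 by rewrite finset.in_setD zB1 zB.
  have [w] := bases_exchange hB hB1 zD.
  rewrite finset.in_setD => /andP[wB wB1] hB'.
  have goodB' : good (w |: B :\ z).
    rewrite /good hB' /=; apply/fintype.subsetP => t tI.
    have tB := fintype.subsetP sB _ tI.
    rewrite !inE tB andbT; apply/orP; right.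
    apply: contraTneq tI => ->.
    by rewrite !inE (negbTE zx) (negbTE zB1).
  have := minB _ goodB'; rewrite leqNgt => /negP[].
  apply: fintype.proper_card; apply/fintype.properP; split; last first.
    have zw : z != w by apply: contraNneq wB => <-.
    by exists z; rewrite !inE (negbTE zx) (negbTE zB1) ?zB // (negbTE zw) eqxx.
  apply/fintype.subsetP => t; rewrite !inE => /andP[tN /orP[/eqP tw|/andP[_ tB]]].
    by move: tN; rewrite tw wB1 orbT.
  by rewrite tN tB.
have : ~~ (B1 \subset B).
  apply: contra xB1 => /(basis_subset_eq hB1 hB) ->.
  by apply: (fintype.subsetP sB); rewrite !inE eqxx.
case/subsetPn => y yB1 yB.
have yD : y \in B1 :\: B by rewrite finset.in_setD yB yB1.
have [w wD hw] := bases_exchange hB1 hB yD.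
have wx : w = x.
  move: wD; rewrite finset.in_setD => /andP[wB1 /(fintype.subsetP BB1)].
  by rewrite !inE (negbTE wB1) orbF => /eqP.
exists y; last by rewrite -wx.
rewrite finset.in_setD yB1 andbT; apply: contra yB => yB2.
by apply: (fintype.subsetP sB); rewrite !inE yB1 yB2 orbT.
Qed.

Definition dual_bases M : {set {set E}} := finset (fun B => ~: B \in bases M).

Fact dual_bases_neq0 M : dual_bases M != finset.set0.
Proof.
have /set0Pn[B hB] := bases_neq0 M.
by apply/set0Pn; exists (~: B); rewrite inE finset.setCK.
Qed.

Fact dual_bases_exchange M B1 B2 x :
  B1 \in dual_bases M -> B2 \in dual_bases M -> x \in B1 :\: B2 ->
  exists2 y, y \in B2 :\: B1 & y |: (B1 :\ x) \in dual_bases M.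
Proof.
rewrite !inE => h1 h2 /andP[xB2 xB1].
have xD : x \in ~: B2 :\: ~: B1 by rewrite !inE xB1 xB2.
have [y yD hy] := bases_exchange_dual h1 h2 xD.
move: yD; rewrite !inE negbK => /andP[yB2 yB1].
exists y; first by rewrite !inE yB1 yB2.
have xy : x != y by apply: contraNneq yB1 => <-.
suff -> : y |: (B1 :\ x) = ~: (x |: (~: B1 :\ y)).
  by rewrite inE finset.setCK.
apply/setP => t; rewrite !inE; have [->|tx] := eqVneq t x.
  by rewrite (negbTE xy).
by case: eqVneq => //=; rewrite negbK.
Qed.

Definition dual M : matroid :=
  Matroid (dual_bases_neq0 M) (@dual_bases_exchange M).

End Matroid.

Section Fan.
Variables (R : realType) (V : lmodType R).
Implicit Types (s t : seq V) (L sigma tau rho : set V) (Sigma : set (set V)).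

Definition cone s : set V :=
  [set x | exists2 c : 'I_(size s) -> R,
     forall i, 0 <= c i & x = \sum_(i < size s) c i *: s`_i].

Definition lin_indep s : Prop :=
  forall c : 'I_(size s) -> R,
    \sum_(i < size s) c i *: s`_i = 0 -> forall i, c i = 0.

Definition lattice_basis L s : Prop :=
  L = [set x | exists z : 'I_(size s) -> int, x = \sum_(i < size s) s`_i *~ z i]
  /\ (forall z : 'I_(size s) -> int,
        \sum_(i < size s) s`_i *~ z i = 0 -> forall i, z i = 0).

Definition face sigma tau : Prop :=
  exists2 m : {scalar V}, forall x, sigma x -> 0 <= m x &
    tau = sigma `&` [set x | m x = 0].

Definition rational_polyhedral L sigma : Prop :=
  exists2 s : seq V, forall v, v \in s -> L v & sigma = cone s.

Definition strongly_convex sigma : Prop :=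
  forall x, sigma x -> sigma (- x) -> x = 0.

(* [Sigma] may be empty: when [E] is empty, the condition on the union of the
   [S_i :&: T_i] leaves no cone in [bipermutohedral_fan] below. *)
Definition is_fan L Sigma : Prop :=
  [/\ finite_set Sigma,
      forall sigma, Sigma sigma ->
        rational_polyhedral L sigma /\ strongly_convex sigma,
      forall sigma tau, Sigma sigma -> face sigma tau -> Sigma tau
    & forall sigma tau, Sigma sigma -> Sigma tau ->
        face sigma (sigma `&` tau) /\ face tau (sigma `&` tau)].

(* Simplicial (independence of [s] over [R]) and unimodular ([s] is part of a
   [Z]-basis of the lattice [L]). *)
Definition smooth_cone L sigma : Prop :=
  exists s t, [/\ lin_indep s, lattice_basis L (s ++ t) & sigma = cone s].

Definition smooth_fan L Sigma : Prop :=
  is_fan L Sigma /\ forall sigma, Sigma sigma -> smooth_cone L sigma.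

Definition is_ray rho : Prop := exists2 v : V, v != 0 & rho = cone [:: v].

Definition cone_rays sigma : set (set V) :=
  [set rho | face sigma rho /\ is_ray rho].

Definition fan_rays Sigma : set (set V) := [set rho | Sigma rho /\ is_ray rho].

Definition induced_subfan Sigma (Rays : set (set V)) : set (set V) :=
  [set sigma | Sigma sigma /\ cone_rays sigma `<=` Rays].

Definition neg_fan Sigma : set (set V) := [set -%R @` sigma | sigma in Sigma].

Definition fan_inter Sigma1 Sigma2 : set (set V) :=
  [set sigma `&` tau | sigma in Sigma1 & tau in Sigma2].

End Fan.

Definition fan_prod (R : realType) (V W : lmodType R)
    (Sigma1 : set (set V)) (Sigma2 : set (set W)) : set (set (V * W)) :=
  [set sigma `*` tau | sigma in Sigma1 & tau in Sigma2].

Section Space.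
Variables (R : realType) (E : finType).

Definition indic (S : {set E}) : {ffun E -> R^o} := [ffun i => (i \in S)%:R].

Definition eE_line : {pred {ffun E -> R^o}} :=
  fun v => `[< exists c : R, v = c *: indic finset.setT >].

Fact eE_line_zmod_closed : zmod_closed eE_line.
Proof.
split; first by apply/asboolP; exists 0; rewrite scale0r.
move=> u v /asboolP[a ->] /asboolP[b ->].
by apply/asboolP; exists (a - b); rewrite scalerBl.
Qed.

Fact eE_line_scale a v : v \in eE_line -> a *: v \in eE_line.
Proof.
by move=> /asboolP[b ->]; apply/asboolP; exists (a * b); rewrite scalerA.
Qed.

HB.instance Definition _ :=
  GRing.isZmodClosed.Build {ffun E -> R^o} eE_line eE_line_zmod_closed.

Definition NE : Type := Quotient.quot eE_line.

HB.instance Definition _ := Choice.on NE.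
HB.instance Definition _ := GRing.Zmodule.on NE.

Definition NE_pi (v : {ffun E -> R^o}) : NE := \pi_(Quotient.quot eE_line) v.

Fact NE_pi_is_zmod_morphism : zmod_morphism NE_pi.
Proof. exact: (raddfB (\pi_(Quotient.quot eE_line))). Qed.

HB.instance Definition _ :=
  GRing.isZmodMorphism.Build {ffun E -> R^o} NE NE_pi NE_pi_is_zmod_morphism.

Lemma NE_piP u v : reflect (NE_pi u = NE_pi v) (u - v \in eE_line).
Proof. by rewrite (Quotient.idealrBE eE_line); apply: eqP. Qed.

Definition NE_repr (x : NE) : {ffun E -> R^o} :=
  repr (x : Quotient.quot eE_line).

Lemma NE_reprK : cancel NE_repr NE_pi.
Proof. by move=> x; rewrite /NE_pi /NE_repr reprK. Qed.

Definition NE_scale (a : R) (x : NE) : NE := NE_pi (a *: NE_repr x).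

Lemma NE_scale_pi a v : NE_scale a (NE_pi v) = NE_pi (a *: v).
Proof.
apply/NE_piP; rewrite -scalerBr; apply: eE_line_scale.
by apply/NE_piP; rewrite NE_reprK.
Qed.

Fact NE_scalerA a b x : NE_scale a (NE_scale b x) = NE_scale (a * b) x.
Proof. by rewrite -[x]NE_reprK !NE_scale_pi scalerA. Qed.

Fact NE_scale1r : left_id 1 NE_scale.
Proof. by move=> x; rewrite -[x]NE_reprK NE_scale_pi scale1r. Qed.

Fact NE_scalerDr : right_distributive NE_scale +%R.
Proof.
move=> a x y; rewrite -[x]NE_reprK -[y]NE_reprK -raddfD !NE_scale_pi.
by rewrite scalerDr raddfD.
Qed.

Fact NE_scalerDl x : {morph NE_scale^~ x : a b / a + b}.
Proof.
by move=> a b; rewrite -[x]NE_reprK !NE_scale_pi scalerDl raddfD.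
Qed.

HB.instance Definition _ := GRing.Zmodule_isLmodule.Build R NE
  NE_scalerA NE_scale1r NE_scalerDr NE_scalerDl.

Fact NE_pi_is_scalable : scalable NE_pi.
Proof. by move=> a v; rewrite -[RHS]/(NE_scale a _) NE_scale_pi. Qed.

HB.instance Definition _ :=
  GRing.isScalable.Build R {ffun E -> R^o} NE *:%R NE_pi NE_pi_is_scalable.

Definition NE_lattice : set NE :=
  [set NE_pi [ffun i => (z i)%:~R] | z in [set: {ffun E -> int}]].

Definition evec (S : {set E}) : NE := NE_pi (indic S).

Local Notation NEE := (NE * NE)%type.

Definition NEE_lattice : set NEE := NE_lattice `*` NE_lattice.

(* [e_S + f_T]: [e] lives in the first summand, [f] in the second. *)
Definition efvec (S T : {set E}) : NEE := (evec S, evec T).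

Definition bergman_fan (M : matroid E) : set (set NE) :=
  [set sigma | exists Fs : seq {set E},
     [/\ sorted (fun A B : {set E} => A \proper B) Fs,
         forall F, F \in Fs ->
           [/\ flat M F, F != finset.set0 & F != finset.setT]
       & sigma = cone [seq evec F | F <- Fs]]].

Definition bisubset (S T : {set E}) : bool :=
  [&& S != finset.set0, T != finset.set0, S :|: T == finset.setT
    & S :&: T != finset.setT].

Definition bipermutohedral_fan : set (set NEE) :=
  [set sigma | exists STs : seq ({set E} * {set E}),
     [/\ forall ST, ST \in STs -> bisubset ST.1 ST.2,
         sorted (fun p q : {set E} * {set E} =>
                   (p.1 \subset q.1) && (q.2 \subset p.2)) STs,
         \bigcup_(ST <- STs) (ST.1 :&: ST.2)%SET != finset.setT
       & sigma = cone [seq efvec ST.1 ST.2 | ST <- STs]]].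

Definition square_conormal_fan (M : matroid E) : set (set NEE) :=
  fan_inter (fan_prod (neg_fan (bergman_fan M)) (bergman_fan (dual M)))
            bipermutohedral_fan.

Definition square_biflat (M : matroid E) : set ({set E} * {set E}) :=
  [set FG | [/\ flat M FG.1, flat (dual M) FG.2 & bisubset (~: FG.1) FG.2]].

Definition square_biflat_ray (FG : {set E} * {set E}) : set NEE :=
  cone [:: efvec (~: FG.1) FG.2].

End Space.

Arguments NE_lattice R E : clear implicits.
Arguments NEE_lattice R E : clear implicits.
Arguments bergman_fan R [E] M.
Arguments bipermutohedral_fan R E : clear implicits.
Arguments square_conormal_fan R [E] M.
Arguments square_biflat_ray R [E] FG.

(* Main.v *)
(** A cone of the bipermutohedral fan is the positive hull of a set of bisubsets
    [S|T] totally ordered by (inclusion of [S], reverse inclusion of [T]), none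
    of whose intersections [S :&: T] contains some fixed [e]. Differences of
    coordinates [x_e - x_a] and [y_a - y_e] give integral functionals dual to
    the generators, which yields simpliciality, all faces, and, by the Smith
    normal form, unimodularity. The generators with positive coefficient can be
    recovered from the point alone, as the level sets of its coordinates, so two
    cones meet in the hull of their common generators. Sending [S] to [S|E]
    transfers this to chains of subsets, so a product of Bergman cones cuts a
    bipermutohedral cone in the hull of the generators [S|T] for which [E - S]
    and [T] are empty, full or members of the two chains of flats. As the empty
    set is a flat of a loopless matroid, these are square biflats. *)

Require Import Defs.
From HB Require Import structures.
From mathcomp Require Import all_boot all_order all_algebra.
From mathcomp Require Import all_classical reals.
From mathcomp Require Import lra.

Set Implicit Arguments.
Unset Strict Implicit.
Unset Printing Implicit Defensive.

Import Order.TTheory GRing.Theory Num.Theory.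

Local Open Scope ring_scope.
Local Open Scope classical_set_scope.

(** * Positive hulls of finite families: faces, rays and dual functionals *)

Section PosHull.
Variables (R : realType) (V : lmodType R).

Lemma cone_mem (s : seq V) v : v \in s -> cone s v.
Proof.
move=> vs; have hi : (index v s < size s)%N by rewrite index_mem.
exists (fun i => (i == Ordinal hi)%:R) => [i|]; first exact: ler0n.
rewrite (bigD1 (Ordinal hi)) //= eqxx scale1r nth_index // big1 ?addr0 // => i.
by move=> /negbTE->; rewrite scale0r.
Qed.

Lemma cone_min (s : seq V) (P : set V) :
  P 0 -> (forall x y, P x -> P y -> P (x + y)) ->
  (forall a x, 0 <= a -> P x -> P (a *: x)) ->
  (forall v, v \in s -> P v) -> cone s `<=` P.
Proof.
move=> P0 PD PZ Ps _ [c c0 ->]; apply: big_ind => // i _.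
by apply: PZ => //; apply/Ps/mem_nth.
Qed.

Lemma cone0 (s : seq V) : cone s 0.
Proof. by exists (fun=> 0) => //; rewrite big1 // => i _; rewrite scale0r. Qed.

Lemma coneD (s : seq V) x y : cone s x -> cone s y -> cone s (x + y).
Proof.
move=> [c c0 ->] [d d0 ->]; exists (fun i => c i + d i) => [i|].
  exact: addr_ge0.
by rewrite -big_split; apply: eq_bigr => i _; rewrite scalerDl.
Qed.

Lemma coneZ (s : seq V) a x : 0 <= a -> cone s x -> cone s (a *: x).
Proof.
move=> a0 [c c0 ->]; exists (fun i => a * c i) => [i|]; first exact: mulr_ge0.
by rewrite scaler_sumr; apply: eq_bigr => i _; rewrite scalerA.
Qed.

Lemma sum_scalar (I : finType) (m : I -> {scalar V}) (A : {set I}) :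
  exists g : {scalar V}, forall x, g x = \sum_(i in A) m i x.
Proof.
pose g x : R^o := \sum_(i in A) m i x.
have lg : linear g.
  move=> a x y; rewrite /g scaler_sumr -big_split; apply: eq_bigr => i _.
  by rewrite linearP.
pose M := GRing.isLinear.Build R V R^o _ g lg.
pose G : {scalar V} := HB.pack g M.
by exists G.
Qed.

Variables (I : finType) (f : I -> V).
Implicit Types A B : {set I}.

(** Indexing generators by a finite set, unlike the sequence in [cone], lets faces and intersections
    of cones be read as subsets and intersections of index sets. *)
Definition pos_hull (A : {set I}) : set V :=
  [set x | exists2 c : I -> R,
     forall i, 0 <= c i & x = \sum_(i in A) c i *: f i].

Lemma pos_hull0 A : pos_hull A 0.
Proof. by exists (fun=> 0) => //; rewrite big1 // => i _; rewrite scale0r. Qed.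

Lemma pos_hullD A x y : pos_hull A x -> pos_hull A y -> pos_hull A (x + y).
Proof.
move=> [c c0 ->] [d d0 ->]; exists (fun i => c i + d i) => [i|].
  exact: addr_ge0.
by rewrite -big_split; apply: eq_bigr => i _; rewrite scalerDl.
Qed.

Lemma pos_hullZ A a x : 0 <= a -> pos_hull A x -> pos_hull A (a *: x).
Proof.
move=> a0 [c c0 ->]; exists (fun i => a * c i) => [i|]; first exact: mulr_ge0.
by rewrite scaler_sumr; apply: eq_bigr => i _; rewrite scalerA.
Qed.

Lemma pos_hull_min A (P : set V) :
  P 0 -> (forall x y, P x -> P y -> P (x + y)) ->
  (forall a x, 0 <= a -> P x -> P (a *: x)) ->
  (forall i, i \in A -> P (f i)) -> pos_hull A `<=` P.
Proof.
move=> P0 PD PZ Pf _ [c c0 ->]; apply: big_ind => // i iA.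
by apply: PZ => //; exact: Pf.
Qed.

Lemma pos_hull_mem A i : i \in A -> pos_hull A (f i).
Proof.
move=> iA; exists (fun j => (j == i)%:R) => [j|]; first exact: ler0n.
rewrite (bigD1 i) //= eqxx scale1r big1 ?addr0 // => j /andP[_ /negbTE->].
by rewrite scale0r.
Qed.

Lemma pos_hullS A B : A \subset B -> pos_hull A `<=` pos_hull B.
Proof.
move=> /fintype.subsetP AB; apply: pos_hull_min;
  [exact: pos_hull0 | exact: pos_hullD | exact: pos_hullZ | ].
by move=> i /AB; exact: pos_hull_mem.
Qed.

Lemma cone_map (s : seq I) : cone [seq f i | i <- s] = pos_hull [set i in s].
Proof.
apply/seteqP; split.
  apply: cone_min;
    [exact: pos_hull0 | exact: pos_hullD | exact: pos_hullZ | ].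
  by move=> _ /mapP[i si ->]; apply: pos_hull_mem; rewrite inE.
apply: pos_hull_min; [exact: cone0 | exact: coneD | exact: coneZ | ].
by move=> i; rewrite inE => si; apply/cone_mem/map_f.
Qed.

Lemma cone_enum (A : {set I}) : cone [seq f i | i <- enum A] = pos_hull A.
Proof.
by rewrite cone_map; congr pos_hull; apply/setP => i; rewrite inE mem_enum.
Qed.

Lemma pos_hull1 i : cone [:: f i] = pos_hull [set i]%SET.
Proof.
rewrite -[[:: f i]]/[seq f j | j <- [:: i]] cone_map; congr pos_hull.
by apply/setP => j; rewrite !inE.
Qed.

(** If [m] is nonnegative on the hull, then [m x = 0] forces every term [c i * m (f i)] to vanish,
    so only generators killed by [m] survive in [x]. *)
Lemma face_pos_hull A tau :
  face (pos_hull A) tau -> exists2 B : {set I}, B \subset A & tau = pos_hull B.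
Proof.
move=> [m m0 ->]; pose B := finset (fun i => (i \in A) && (m (f i) == 0)).
have BA : B \subset A by apply/fintype.subsetP => i; rewrite inE => /andP[].
exists B => //; apply/seteqP; split => [x [[c c0 xE] /= mx]|x Bx].
  have mterm i : i \in A -> 0 <= c i * m (f i).
    by move=> iA; apply: mulr_ge0 => //; apply/m0/pos_hull_mem.
  have : \sum_(i in A) c i * m (f i) = 0.
    transitivity (m x) => //; rewrite xE linear_sum; apply: eq_bigr => i _.
    by rewrite linearZ.
  move=> /(psumr_eq0P mterm) cm0.
  exists c => //; rewrite xE (bigID (fun i => m (f i) == 0)) /=.
  rewrite [X in _ + X]big1 ?addr0.
    by apply: eq_bigl => i; rewrite inE.
  move=> i /andP[iA mi]; have /eqP := cm0 _ iA.
  by rewrite mulf_eq0 (negbTE mi) orbF => /eqP->; rewrite scale0r.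
split; first exact: pos_hullS BA _ Bx.
move: x Bx; apply: (@pos_hull_min B [set x | m x = 0]) => /=.
- exact: linear0.
- by move=> x y mx my; rewrite linearD mx my addr0.
- by move=> a x _ mx; rewrite linearZ /= mx mulr0.
- by move=> i; rewrite inE => /andP[_ /eqP].
Qed.

(** Coordinate functionals for the generators. Their existence makes the family independent, and
    every subset of generators then spans a face. *)
Definition dual_system (A : {set I}) (m : I -> {scalar V}) : Prop :=
  forall i j, i \in A -> j \in A -> m i (f j) = (i == j)%:R.

Variables (A : {set I}) (m : I -> {scalar V}).
Hypothesis mA : dual_system A m.

Lemma dual_system_coord (c : I -> R) i :
  i \in A -> m i (\sum_(j in A) c j *: f j) = c i.
Proof.
move=> iA; rewrite linear_sum (bigD1 i) //= linearZ /= mA // eqxx mulr1.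
rewrite big1 ?addr0 // => j /andP[jA ji].
by rewrite linearZ /= mA // eq_sym (negbTE ji) mulr0.
Qed.

(** The sum of the coordinates indexed by [A :\: B] is nonnegative on the hull and vanishes only
    where each of them does. *)
Lemma pos_hull_face (B : {set I}) :
  B \subset A -> face (pos_hull A) (pos_hull B).
Proof.
move=> BA; have [g gE] := sum_scalar m (A :\: B).
have gA c : g (\sum_(j in A) c j *: f j) = \sum_(j in A :\: B) c j.
  rewrite gE; apply: eq_bigr => i; rewrite inE => /andP[_ iA].
  exact: dual_system_coord.
exists g; first by move=> _ [c c0 ->]; rewrite gA sumr_ge0.
apply/seteqP; split => [x Bx|x [[c c0 ->]] /=].
  split; first exact: pos_hullS BA _ Bx.
  move: x Bx; apply: (@pos_hull_min B [set x | g x = 0]) => /=.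
  - exact: linear0.
  - by move=> x y mx my; rewrite linearD mx my addr0.
  - by move=> a x _ mx; rewrite linearZ /= mx mulr0.
  - move=> i iB; rewrite gE big1 // => j; rewrite inE => /andP[jB jA].
    rewrite mA // ?(fintype.subsetP BA) //.
    by have [ji|//] := eqVneq j i; rewrite ji iB in jB.
rewrite gA => /psumr_eq0P cD; exists c => //.
rewrite (big_setID B) /= (finset.setIidPr BA) [X in _ + X]big1 ?addr0 // => i iD.
by rewrite cD ?scale0r // => j _.
Qed.

Lemma pos_hull_strongly_convex : strongly_convex (pos_hull A).
Proof.
move=> x [c c0 xE] [d d0 NxE]; rewrite xE big1 // => i iA.
have ci := dual_system_coord c iA; have di := dual_system_coord d iA.
rewrite -xE in ci; rewrite -NxE linearN /= ci in di.
suff -> : c i = 0 by rewrite scale0r.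
by apply/eqP; rewrite eq_le c0 andbT -oppr_ge0 di.
Qed.

(** All generators are multiples of the vector [w] spanning the ray, whereas the functional dual to
    one of two distinct generators separates them. *)
Lemma is_ray_pos_hull : is_ray (pos_hull A) -> exists i, A = [set i]%SET.
Proof.
move=> [w w0 Aw].
have : pos_hull A w by rewrite Aw; apply: cone_mem; rewrite inE.
move=> [c _ wE].
have [A0|[i iA]] := set_0Vmem A.
  by move: w0; rewrite wE A0 big_set0 eqxx.
have multiple j : j \in A -> exists a : R, f j = a *: w.
  move=> /pos_hull_mem; rewrite Aw => -[a _ ->]; exists (a ord0).
  by rewrite big_ord1.
exists i; apply/setP => j; rewrite inE; apply/idP/eqP => [jA|->//].
have [a fi] := multiple _ iA; have [b fj] := multiple _ jA.
apply/eqP; apply: contraT => ji.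
have := mA iA iA; rewrite eqxx fi linearZ /= => mi.
have := mA iA jA; rewrite eq_sym (negbTE ji) fj linearZ /= => /eqP.
rewrite mulf_eq0 => /orP[/eqP b0|/eqP mw].
  have := mA jA jA; rewrite fj b0 scale0r linear0 eqxx => /eqP.
  by rewrite eq_sym oner_eq0.
by move: mi => /eqP; rewrite mw mulr0 eq_sym oner_eq0.
Qed.

Lemma dual_system_lin_indep : lin_indep [seq f i | i <- enum A].
Proof.
pose t := in_tuple (enum A); rewrite /lin_indep size_map => c c0 k.
have tA j : tnth t j \in A by rewrite -mem_enum mem_tnth.
have t_inj : injective (tnth t) by apply/tuple_uniqP; exact: enum_uniq.
have nthE (j : 'I_(size (enum A))) : [seq f i | i <- enum A]`_j = f (tnth t j).
  by rewrite (tnth_nth (tnth t j)) (nth_map (tnth t j)).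
have := linear0 (m (tnth t k)); rewrite -[in LHS]c0 linear_sum (bigD1 k) //=.
rewrite linearZ /= nthE mA // eqxx mulr1 big1 ?addr0 // => j jk.
by rewrite linearZ /= nthE mA // (inj_eq t_inj) eq_sym (negbTE jk) mulr0.
Qed.

End PosHull.

(* By the Smith normal form [M = P *m D *m Q]: the right inverse forces the
   elementary divisors to be units, so the last [r] rows of [Q] complete [M]. *)
Lemma unimodular_completion (k r : nat) (M : 'M[int]_(k, k + r))
    (W : 'M[int]_(k + r, k)) :
  M *m W = 1%:M -> exists T : 'M[int]_(r, k + r), col_mx M T \in unitmx.
Proof.
have [P Pu [Q Qu [d _ ->]]] := int_Smith_normal_form M.
set D := (\matrix_(i, j) _ : 'M_(k, k + r)) => MW.
have DE : D = row_mx (lsubmx D) 0.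
  rewrite -[LHS]hsubmxK; congr row_mx; apply/matrixP => i j; rewrite !mxE /=.
  by rewrite ltn_eqF ?mulr0n // (leq_trans (ltn_ord i)) ?leq_addr.
set D0 := lsubmx D in DE *.
have D0u : D0 \in unitmx.
  have : D *m (Q *m W) = invmx P.
    by rewrite -[RHS]mulmx1 -MW !mulmxA mulVmx // mul1mx.
  rewrite DE -[Q *m W]vsubmxK mul_row_col mul0mx addr0 => DX.
  have : D0 *m (usubmx (Q *m W) *m P) = 1%:M by rewrite mulmxA DX mulVmx.
  by case/mulmx1_unit.
exists (dsubmx Q).
have -> : col_mx (P *m D *m Q) (dsubmx Q) = block_mx (P *m D0) 0 0 1%:M *m Q.
  rewrite -[in RHS](vsubmxK Q) mul_block_col !mul0mx mul1mx addr0 add0r.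
  congr col_mx; rewrite -mulmxA DE -[in LHS](vsubmxK Q) mul_row_col mul0mx.
  by rewrite addr0 mulmxA.
by rewrite unitmx_mul Qu block_diag_mx_unit unitmx1 unitmx_mul Pu D0u.
Qed.

(** * Completing a family with integral dual functionals to a lattice basis *)

Section LatticeBasis.
Variables (R : realType) (V : lmodType R).
Implicit Types (L : set V) (s t : seq V).

Definition zspan n (b : 'I_n -> V) (z : 'I_n -> int) : V :=
  \sum_(i < n) b i *~ z i.

Definition zbasis L n (b : 'I_n -> V) : Prop :=
  L = range (zspan b) /\
  (forall z : 'I_n -> int, zspan b z = 0 -> forall i, z i = 0).

Lemma zbasis_seq L s : zbasis L (fun i : 'I_(size s) => s`_i) -> lattice_basis L s.
Proof.
rewrite /lattice_basis /zbasis.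
suff -> : range (zspan (fun i : 'I_(size s) => s`_i)) =
  [set x | exists z : 'I_(size s) -> int, x = \sum_(i < size s) s`_i *~ z i].
  by [].
by apply/seteqP; split => x /= [z]; [move=> _ <-|move=> ->]; exists z.
Qed.

Lemma zbasis_dual L (J : finType) (b : J -> V) (m : J -> {scalar V}) :
  (forall i j, m i (b j) = (i == j)%:R) ->
  L = [set x | exists z : J -> int, x = \sum_j b j *~ z j] ->
  zbasis L (fun i : 'I_#|J| => b (enum_val i)).
Proof.
move=> mb ->; split.
  apply/seteqP; split => x /= [z].
    move=> ->; exists (z \o enum_val) => //.
    by rewrite [RHS](reindex _ (onW_bij _ (enum_val_bij J))).
  move=> _ <-; exists (z \o enum_rank).
  rewrite (reindex _ (onW_bij _ (enum_val_bij J))).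
  by apply: eq_bigr => i _; rewrite /= enum_valK.
move=> z z0 i; apply: (@intr_inj R).
have := congr1 (m (enum_val i)) z0; rewrite linear0 linear_sum (bigD1 i) //=.
rewrite raddfMz /= mb eqxx.
rewrite big1 ?addr0 // => j ji.
by rewrite raddfMz /= mb (inj_eq enum_val_inj) eq_sym (negbTE ji) mul0rz.
Qed.

(** Coordinates are row vectors: passing from [b] to the combinations given by the rows of [U]
    multiplies them by [U] on the right. *)
Lemma zspan_mulmx n (b : 'I_n -> V) (U : 'M[int]_n) (z : 'rV[int]_n) :
  zspan (fun i => zspan b (U i)) (z 0) = zspan b ((z *m U) 0).
Proof.
rewrite /zspan; under eq_bigr => i _ do rewrite mulrz_suml.
rewrite exchange_big; apply: eq_bigr => j _; rewrite mxE mulrz_sumr.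
by apply: eq_bigr => i _; rewrite -mulrzA mulrC.
Qed.

Lemma zbasis_unitmx L n (b : 'I_n -> V) (U : 'M[int]_n) :
  U \in unitmx -> zbasis L b -> zbasis L (fun i => zspan b (U i)).
Proof.
move=> Uu [LE b0]; split.
  rewrite LE; apply/seteqP; split => _ [z _ <-].
    exists (((\row_i z i) *m invmx U) 0) => //.
    by rewrite zspan_mulmx mulmxKV //; congr zspan; apply/funext => i; rewrite mxE.
  have -> : z = (\row_i z i) 0 by apply/funext => i; rewrite mxE.
  by rewrite zspan_mulmx; eexists.
move=> z z0 i.
have zE : z = (\row_i z i) 0 by apply/funext => j; rewrite mxE.
have zU : (\row_i z i) *m U = 0.
  by apply/rowP => j; rewrite [RHS]mxE b0 // -zspan_mulmx -zE.
by rewrite zE -[\row_i z i](mulmxK Uu) zU mul0mx mxE.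
Qed.

(** The values of the dual functionals on [b] form an integral right inverse of the coordinate
    matrix of [s], which is what [unimodular_completion] asks for. *)
Lemma zbasis_completion L n (b : 'I_n -> V) k (s : 'I_k -> V)
    (m : 'I_k -> {scalar V}) :
  zbasis L b -> (forall i, L (s i)) ->
  (forall i x, L x -> exists z : int, m i x = z%:~R) ->
  (forall i j, m i (s j) = (i == j)%:R) ->
  exists r (t : 'I_r -> V),
    zbasis L (fun i => match fintype.split i with inl j => s j | inr j => t j end).
Proof.
move=> Lb Ls mL ms.
have bL j : L (b j).
  case: Lb => -> _; exists (fun i => (i == j)%:R) => //.
  rewrite /zspan (bigD1 j) //= eqxx big1 ?addr0 // => i /negbTE->.
  by rewrite mulr0z.
have /choice[M ME] i : exists z, zspan b z = s i.
  by have := Ls i; case: Lb => -> _ [z _ <-]; exists z.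
have /choice[W WE] i : exists z : 'I_n -> int, forall j, m i (b j) = (z j)%:~R.
  have /choice[z zE] j : exists z : int, m i (b j) = z%:~R by exact: mL.
  by exists z.
pose MX := \matrix_(i, j) M i j; pose WX := \matrix_(i, j) W j i.
have MW : MX *m WX = 1%:M.
  apply/matrixP => i j; apply: (@intr_inj R); rewrite !mxE.
  transitivity (m j (s i)).
    rewrite -ME linear_sum rmorph_sum; apply: eq_bigr => l _.
    by rewrite !mxE rmorphM /= -WE raddfMz /= mulrzl.
  by rewrite ms eq_sym; case: eqP.
(* A one-sided inverse forces [k <= n], so that [n] can be rewritten as [k + r]. *)
have kn := mulmx1_min MW.
exists (n - k)%N; move: (n - k)%N (subnKC kn) => r kr; subst n.
have [T MTu] := unimodular_completion MW.
exists (fun i => zspan b (T i)).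
have := zbasis_unitmx MTu Lb; congr zbasis; apply/funext => i.
case: fintype.splitP => j ij.
  rewrite -ME; have -> : i = lshift r j by apply/val_inj.
  by congr zspan; apply/funext => l; rewrite col_mxEu mxE.
have -> : i = rshift k j by apply/val_inj.
by congr zspan; apply/funext => l; rewrite col_mxEd.
Qed.

Lemma lattice_basis_completion L n (b : 'I_n -> V) s (m : 'I_(size s) -> {scalar V}) :
  zbasis L b -> (forall v, v \in s -> L v) ->
  (forall i x, L x -> exists z : int, m i x = z%:~R) ->
  (forall i j : 'I_(size s), m i s`_j = (i == j)%:R) ->
  exists t, lattice_basis L (s ++ t).
Proof.
move=> Lb Ls mL ms.
have [|//|//|r [t Lst]] := zbasis_completion Lb (s := fun i => s`_i) (m := m).
  by move=> i; apply/Ls/mem_nth.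
exists [seq t i | i <- enum 'I_r]; apply: zbasis_seq.
have szE : size (s ++ [seq t i | i <- enum 'I_r]) = (size s + r)%N.
  by rewrite size_cat size_map size_enum_ord.
have nthE (i : 'I_(size s + r)) : (s ++ [seq t i | i <- enum 'I_r])`_i =
    match fintype.split i with inl j => s`_j | inr j => t j end.
  rewrite nth_cat; case: fintype.splitP => j -> //.
  by rewrite addKn (nth_map j) ?size_enum_ord // nth_ord_enum.
rewrite szE; move: Lst; congr zbasis; apply/funext => i.
by rewrite nthE.
Qed.

End LatticeBasis.

(** * Coordinate differences as functionals on the quotient space *)

Section NECoordinates.
Variables (R : realType) (E : finType).
Local Notation NE := (NE R E).
Local Notation NEE := (NE * NE)%type.

(** A single coordinate is not defined modulo [e_E]; a difference of two is, whichever
    representative is taken. *)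
Definition NE_diff (a b : E) (x : NE) : R := NE_repr x a - NE_repr x b.

Lemma NE_diff_pi a b u : NE_diff a b (NE_pi u) = u a - u b.
Proof.
have /NE_piP/asboolP[c cE] := NE_reprK (NE_pi u).
have {}cE i : NE_repr (NE_pi u) i = u i + c.
  have /ffunP/(_ i) := cE; rewrite !ffunE inE /GRing.scale /= mulr1 => <-.
  by rewrite addrC subrK.
by rewrite /NE_diff !cE opprD addrACA subrr addr0.
Qed.

Fact NE_diff_linear a b : linear_for *%R (NE_diff a b).
Proof.
move=> k x y; rewrite -[x]NE_reprK -[y]NE_reprK -linearZ -linearD !NE_diff_pi.
by rewrite !ffunE opprD addrACA mulrBr.
Qed.

HB.instance Definition _ a b :=
  GRing.isLinear.Build R NE R *%R (NE_diff a b) (NE_diff_linear a b).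

Lemma NE_diff_evec a b S :
  NE_diff a b (evec R S) = (a \in S)%:R - (b \in S)%:R.
Proof. by rewrite NE_diff_pi !ffunE. Qed.

Lemma NE_diff_lattice a b x :
  NE_lattice R E x -> exists z : int, NE_diff a b x = z%:~R.
Proof.
move=> [z _ <-]; exists (z a - z b).
by rewrite NE_diff_pi !ffunE rmorphB.
Qed.

Definition xdiff a b : {scalar NEE} := NE_diff a b \o fst.
Definition ydiff a b : {scalar NEE} := NE_diff a b \o snd.

End NECoordinates.

(** * Integral functionals and a basis of the lattice *)

Section NEELattice.
Variables (R : realType) (E : finType).
Local Notation NE := (NE R E).
Local Notation NEE := (NE * NE)%type.
Implicit Types (a b e : E) (p q : {set E} * {set E}) (A B : {set {set E} * {set E}}).

Definition integral (m : {scalar NEE}) : Prop :=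
  forall x, NEE_lattice R E x -> exists z : int, m x = z%:~R.

Lemma xdiff_integral a b : integral (xdiff R a b).
Proof. by move=> x [x1 _]; exact: NE_diff_lattice. Qed.

Lemma ydiff_integral a b : integral (ydiff R a b).
Proof. by move=> x [_ x2]; exact: NE_diff_lattice. Qed.

Lemma integralB (m m' : {scalar NEE}) :
  integral m -> integral m' -> integral (m \- m').
Proof.
move=> mi m'i x Lx; have [z mz] := mi x Lx; have [z' m'z] := m'i x Lx.
by exists (z - z'); rewrite /= mz m'z rmorphB.
Qed.

Lemma efvec_lattice S T : NEE_lattice R E (efvec R S T).
Proof.
by split; [exists [ffun i => (i \in S)%:R] | exists [ffun i => (i \in T)%:R]] => //;
  rewrite /=/evec; congr NE_pi; apply/ffunP => i; rewrite !ffunE mulrz_nat.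
Qed.

(** Subtracting [z e] times [e_E] does not change the class and makes the coordinate at [e] zero. *)
Lemma NE_pi_int_span e (z : {ffun E -> int}) :
  NE_pi [ffun i => (z i)%:~R] =
  \sum_(a : {a | a != e}) evec R [set val a]%SET *~ (z (val a) - z e).
Proof.
transitivity (NE_pi (\sum_a (indic R [set a]%SET *~ (z a - z e)))).
  apply/NE_piP/asboolP; exists (z e)%:~R; apply/ffunP => i.
  rewrite !ffunE sum_ffunE (bigD1 i) //= big1 ?addr0.
    rewrite -[indic _ _ *~ _]scaler_int !ffunE !inE eqxx /GRing.scale /= !mulr1 rmorphB.
    by rewrite subKr.
  move=> a ai; rewrite -[indic _ _ *~ _]scaler_int !ffunE inE eq_sym.
  by rewrite (negbTE ai) scaler0.
rewrite raddf_sum (bigD1 e) //= subrr mulr0z raddf0 add0r.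
rewrite (reindex_omap (val : {a | a != e} -> E) insub) => [|a ae]; last by rewrite insubT.
apply: eq_big => [a|a _]; last by rewrite raddfMz.
by rewrite valK eqxx (valP a).
Qed.

Definition unit_vec e (j : {a | a != e} + {a | a != e}) : NEE :=
  match j with
  | inl a => (evec R [set val a]%SET, 0)
  | inr a => (0, evec R [set val a]%SET)
  end.

Lemma unit_vec_sum e (z : {a | a != e} + {a | a != e} -> int) :
  \sum_j unit_vec j *~ z j =
  (\sum_a evec R [set val a]%SET *~ z (inl a),
   \sum_a evec R [set val a]%SET *~ z (inr a)).
Proof.
rewrite big_sumType /= [LHS]surjective_pairing; congr pair => /=.
  rewrite !raddf_sum /= [X in _ + X]big1 ?addr0.
    by apply: eq_bigr => i _; rewrite raddfMz.
  by move=> i _; rewrite raddfMz mul0rz.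
rewrite !raddf_sum /= [X in X + _]big1 ?add0r.
  by apply: eq_bigr => i _; rewrite raddfMz.
by move=> i _; rewrite raddfMz mul0rz.
Qed.

Lemma NE_int_span_lattice e (z : {a | a != e} -> int) :
  NE_lattice R E (\sum_a evec R [set val a]%SET *~ z a).
Proof.
(* Extending [z] by the default 0 at [e] makes the subtracted constant vanish. *)
exists [ffun a => oapp z 0 (insub a)] => //; rewrite (NE_pi_int_span e).
apply: eq_bigr => a _.
by rewrite !ffunE valK [insub e]insubF ?eqxx //= subr0.
Qed.

(** The unit vectors away from [e], in both summands, have the coordinate differences against [e] as
    dual functionals. *)
Lemma NEE_zbasis e :
  zbasis (NEE_lattice R E)
    (fun i : 'I_#|{: {a | a != e} + {a | a != e}}| => unit_vec (enum_val i)).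
Proof.
pose m j := match j : {a | a != e} + {a | a != e} with
  | inl a => xdiff R (val a) e | inr a => ydiff R (val a) e end.
apply: (zbasis_dual (m := m)).
  move=> [] i [] j /=; rewrite /= ?linear0 // NE_diff_evec !inE;
  by rewrite [e == _]eq_sym (negbTE (valP j)) subr0.
apply/seteqP; split => [[x y] [/= [z _ <-] [w _ <-]]|_ [z ->]] /=.
  exists (fun j => match j with
    | inl a => z (val a) - z e | inr a => w (val a) - w e end).
  by rewrite unit_vec_sum !(NE_pi_int_span e).
by rewrite unit_vec_sum; split; exact: NE_int_span_lattice.
Qed.
End NEELattice.

(** * Chains of bisubsets and their dual functionals *)

Section Biflag.
Variables (R : realType) (E : finType).
Local Notation NE := (NE R E).
Local Notation NEE := (NE * NE)%type.
Local Notation pair := ({set E} * {set E})%type.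
Implicit Types (a b e : E) (p q : pair) (A B : {set pair}).
Local Notation efv := (fun p : pair => efvec R p.1 p.2).

Definition bisubset_le p q := (p.1 \subset q.1) && (q.2 \subset p.2).

(** The generating data of a bipermutohedral cone without the ordering of a list; the element [e]
    witnesses that the intersections do not cover [E]. *)
Definition biflag A : Prop :=
  [/\ forall p, p \in A -> bisubset p.1 p.2,
      {in A &, total bisubset_le}
    & exists e, forall p, p \in A -> e \notin p.1 :&: p.2].

(** Strictly increasing for [bisubset_le], so on a biflag the order can be handled through natural
    numbers. *)
Definition height p : nat := #|p.1| + #|~: p.2|.

Lemma height_le A : biflag A ->
  {in A &, forall p q, (height p <= height q)%N -> bisubset_le p q}.
Proof.
move=> [_ Atot _] p q pA qA pq; case/orP: (Atot p q pA qA) => // /andP[q1 p2].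
have c1 := subset_leq_card q1.
have c2 : (#|~: q.2| <= #|~: p.2|)%N by rewrite subset_leq_card // finset.setCS.
have /eqP E1 : q.1 == p.1.
  rewrite eqEcard q1 -(leq_add2r #|~: q.2|) (leq_trans _ pq) //.
  by rewrite leq_add2l.
have /eqP E2 : ~: q.2 == ~: p.2.
  rewrite eqEcard finset.setCS p2 -(leq_add2l #|p.1|) (leq_trans pq) //.
  by rewrite leq_add2r.
by rewrite /bisubset_le E1 -[q.2]finset.setCK E2 finset.setCK !fintype.subxx.
Qed.

Lemma height_inj A : biflag A -> {in A &, injective height}.
Proof.
move=> bA [p1 p2] [q1 q2] pA qA pq.
have /andP[/= pq1 qp2] := height_le bA pA qA (eq_leq pq).
have /andP[/= qp1 pq2] := height_le bA qA pA (eq_leq (esym pq)).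
by congr (_, _); apply/eqP; rewrite finset.eqEsubset; apply/andP.
Qed.

Lemma biflagS A B : B \subset A -> biflag A -> biflag B.
Proof.
move=> /fintype.subsetP BA [Abi Atot [e eA]]; split.
- by move=> p /BA/Abi.
- by move=> p q /BA pA /BA; exact: Atot.
- by exists e => p /BA/eA.
Qed.

Lemma bisubset_cover p a : bisubset p.1 p.2 -> (a \in p.1) || (a \in p.2).
Proof. by case/and4P => _ _ /eqP/setP/(_ a) + _; rewrite !inE. Qed.

Lemma biflag1 p : bisubset p.1 p.2 -> biflag [set p]%SET.
Proof.
move=> bp; split.
- by move=> q; rewrite inE => /eqP->.
- move=> q r; rewrite !inE => /eqP-> /eqP->.
  by rewrite /bisubset_le !fintype.subxx.
case/and4P: bp => _ _ _; rewrite -finset.subTset => /subsetPn[e _ ep].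
by exists e => q; rewrite inE => /eqP->.
Qed.

(* The functional reads off whether the height of a member of [A] is below that
   of [p], up to a normalization which does not depend on [p]. *)
Lemma biflag_threshold A p e : biflag A ->
  (forall q, q \in A -> e \notin q.1 :&: q.2) -> p \in A ->
  exists2 m : {scalar NEE}, integral m & forall q, q \in A ->
    m (efv q) = (height q < height p)%:R - (e \notin q.1)%:R.
Proof.
move=> bA eA pA; have [Abi _ _] := bA.
have e2 q : q \in A -> (e \in q.2) = (e \notin q.1).
  move=> qA; have := eA _ qA; have := bisubset_cover e (Abi _ qA).
  by rewrite inE; case: (e \in q.1); case: (e \in q.2).
have ex a (q : pair) : xdiff R e a (efv q) = (a \notin q.1)%:R - (e \notin q.1)%:R.
  rewrite /= NE_diff_evec; case: (a \in q.1); case: (e \in q.1) => /=;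
  by rewrite ?subrr ?subr0 ?sub0r.
(* It suffices to find an [a] missing from the first entry of exactly the members below [p]. *)
have below a : (forall q, q \in A -> (a \notin q.1) = (height q < height p)%N) ->
    exists2 m : {scalar NEE}, integral m & forall q, q \in A ->
      m (efv q) = (height q < height p)%:R - (e \notin q.1)%:R.
  move=> aA; exists (xdiff R e a); first exact: xdiff_integral.
  by move=> q qA; rewrite ex aA.
have [/existsP[q0 q0P]|noq] :=
    boolP [exists q, (q \in A) && (height q < height p)%N].
  have [q /andP[qA qp] qmax] :=
    @arg_maxnP _ q0 (fun q => (q \in A) && (height q < height p)%N) height q0P.
  have low r : r \in A -> (height r < height p)%N -> bisubset_le r q.
    by move=> rA rp; apply: (height_le bA) => //; apply: qmax; rewrite rA.
  have high r : r \in A -> (height p <= height r)%N -> bisubset_le p r.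
    by move=> rA; exact: (height_le bA).
  have /andP[qp1 pq2] := height_le bA qA pA (ltnW qp).
  (* Here [q] is the predecessor of [p]. From [q] to [p] either the first entry gains some [a] or
     the second loses one; this [a] marks the threshold. *)
  have [p1q|/subsetPn[a ap aq]] := boolP (p.1 \subset q.1); last first.
    apply: (below a) => r rA; case: ltnP => [rp|pr].
      by have /andP[/fintype.subsetP/(_ a)/contra->] := low _ rA rp.
    by have /andP[/fintype.subsetP->] := high _ rA pr.
  have [q2p|/subsetPn[a aq ap]] := boolP (q.2 \subset p.2).
    have /(height_inj bA)  : height q = height p.
      rewrite /height; congr (_ + _)%N; apply: eq_card => x.
        by rewrite (_ : q.1 = p.1) //; apply/eqP; rewrite finset.eqEsubset qp1.
      by rewrite (_ : q.2 = p.2) //; apply/eqP; rewrite finset.eqEsubset q2p.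
    by move=> qpE; rewrite qpE ?ltnn in qp.
  exists (ydiff R a e); first exact: ydiff_integral.
  move=> r rA; rewrite /= NE_diff_evec e2 //; congr (_%:R - _).
  case: ltnP => [rp|pr].
    by have /andP[_ /fintype.subsetP->] := low _ rA rp.
  by have /andP[_ /fintype.subsetP/(_ a)/contra/(_ ap)/negbTE->] := high _ rA pr.
(* With [p] lowest, any [a] in [p.1] lies in every first entry, matching a threshold that no member
   is below. *)
have /and4P[/set0Pn[a ap] _ _ _] := Abi _ pA.
apply: (below a) => q qA; have pq : (height p <= height q)%N.
  by rewrite leqNgt; apply: contra noq => qp; apply/existsP; exists q; rewrite qA.
rewrite ltnNge pq; have /andP[/fintype.subsetP-> //] := height_le bA pA qA pq.
Qed.

(** The indicator of [p] is the difference of two consecutive thresholds, in which the common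
    normalization cancels. *)
Lemma biflag_dual_system A : biflag A ->
  exists2 m : pair -> {scalar NEE},
    (forall p, p \in A -> integral (m p)) & dual_system efv A m.
Proof.
move=> bA; have [Abi _ [e eA]] := bA.
suff /choice[m mP] p : exists m : {scalar NEE}, p \in A ->
    integral m /\ forall q, q \in A -> m (efv q) = (p == q)%:R.
  by exists m => [p /mP[]//|p q /mP[_ /(_ q)]].
have [pA|_] := boolP (p \in A); last by exists \0.
have [m mi mE] := biflag_threshold bA eA pA.
(* The inclusive threshold at [p] is the strict one at its successor; if [p] is highest, an element
   of [p.2] lies in every second entry and serves instead. *)
have [m' m'i m'E] : exists2 m : {scalar NEE}, integral m & forall q, q \in A ->
    m (efv q) = (height q <= height p)%:R - (e \notin q.1)%:R.
  have [/existsP[q0 q0P]|noq] :=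
      boolP [exists q, (q \in A) && (height p < height q)%N].
    have [q /andP[qA qp] qmin] :=
      @arg_minnP _ q0 (fun q => (q \in A) && (height p < height q)%N) height q0P.
    have [m' m'i m'E] := biflag_threshold bA eA qA.
    exists m' => // r rA; rewrite m'E //; congr (_%:R - _).
    rewrite [in RHS]leqNgt; case: ltnP => [rq|qr].
      by case: ltnP => // pr; have := qmin r; rewrite rA pr leqNgt rq => /(_ isT).
    by rewrite (leq_trans qp qr).
  have /and4P[_ /set0Pn[a ap] _ _] := Abi _ pA.
  exists (ydiff R a e); first exact: ydiff_integral.
  move=> q qA; have qp : (height q <= height p)%N.
    by rewrite leqNgt; apply: contra noq => pq; apply/existsP; exists q; rewrite qA.
  rewrite qp /= NE_diff_evec.
  have /andP[_ /fintype.subsetP->//] := height_le bA qA pA qp.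
  congr (_ - _%:R); have := eA _ qA; have := bisubset_cover e (Abi _ qA).
  by rewrite inE; case: (e \in q.1); case: (e \in q.2).
exists (m' \- m) => _; split; first exact: integralB.
move=> q qA; rewrite /= mE // m'E // opprB addrA subrK.
rewrite -(inj_in_eq (height_inj bA)) //.
by case: (ltngtP (height q) (height p)) => _; rewrite ?subrr ?subr0.
Qed.

(** * Recovering the generators with positive coefficient from a point *)

Section Support.
Variables (A : {set pair}) (c : pair -> R).
Hypotheses (bA : biflag A) (c0 : forall p, 0 <= c p).

(** Running total of the coefficients in order of height. The next two sums are the coordinates of
    the point up to constants: [mass_out1] is minus the first component, [mass_in2] the second. *)
Definition mass_below (n : nat) : R := \sum_(p in A) c p *+ (height p < n).
Definition mass_out1 a : R := \sum_(p in A) c p *+ (a \notin p.1).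
Definition mass_in2 a : R := \sum_(p in A) c p *+ (a \in p.2).

Lemma ler_mass (P Q : pred pair) : (forall p, p \in A -> P p -> Q p) ->
  \sum_(p in A) c p *+ P p <= \sum_(p in A) c p *+ Q p.
Proof.
move=> PQ; apply: ler_sum => p pA.
by case: (P p) (PQ p pA) => [->//|_]; rewrite mulrn_wge0.
Qed.

(** The members with [a] outside the first entry form an initial segment of the chain, as do those
    with [a] in the second entry. This and the next three lemmas compare the end of such a segment
    with [p]. *)
Lemma mass_out1_in p a : p \in A -> a \in p.1 -> mass_out1 a <= mass_below (height p).
Proof.
move=> pA ap; apply: ler_mass => q qA; apply: contraR; rewrite -leqNgt => pq.
by have /andP[/fintype.subsetP->] := height_le bA pA qA pq.
Qed.

Lemma mass_out1_out p a :
  p \in A -> a \notin p.1 -> mass_below (height p).+1 <= mass_out1 a.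
Proof.
move=> pA ap; apply: ler_mass => q qA; rewrite ltnS => qp.
by have /andP[/fintype.subsetP/(_ a)/contra->] := height_le bA qA pA qp.
Qed.

Lemma mass_in2_in p a :
  p \in A -> a \in p.2 -> mass_below (height p).+1 <= mass_in2 a.
Proof.
move=> pA ap; apply: ler_mass => q qA; rewrite ltnS => qp.
by have /andP[_ /fintype.subsetP->] := height_le bA qA pA qp.
Qed.

Lemma mass_in2_out p a :
  p \in A -> a \notin p.2 -> mass_in2 a <= mass_below (height p).
Proof.
move=> pA ap; apply: ler_mass => q qA; apply: contraTT; rewrite -leqNgt => pq.
by have /andP[_ /fintype.subsetP/(_ a)/contra->] := height_le bA pA qA pq.
Qed.

Lemma mass_out1_le a : mass_out1 a <= mass_in2 a.
Proof.
have [Abi _ _] := bA; apply: ler_mass => p /Abi/(bisubset_cover a).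
by case: (a \in p.1).
Qed.

(** An [e] avoiding all the intersections lies in exactly one entry of each bisubset. *)
Lemma mass_balanced : exists e, mass_out1 e = mass_in2 e.
Proof.
have [Abi _ [e eA]] := bA; exists e; apply: eq_bigr => p pA.
have := bisubset_cover e (Abi _ pA); have := eA _ pA.
by rewrite inE; case: (e \in p.1); case: (e \in p.2).
Qed.

Lemma mass_below_jump p :
  p \in A -> 0 < c p -> mass_below (height p) < mass_below (height p).+1.
Proof.
move=> pA cp; rewrite /mass_below (bigD1 p) //= [ltRHS](bigD1 p) //=.
rewrite ltnn ltnS leqnn add0r ltr_pwDl //; apply: ler_sum => q _.
have [qp|//] := ltnP; first by rewrite ltnS ltnW.
by move=> _; exact: mulrn_wge0.
Qed.

(** The two bounds place [t] between 0 and the total mass, and the jumps of [mass_below] occur only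
    at heights of members with positive coefficient. *)
Lemma mass_level t a b : mass_out1 a <= t -> t < mass_in2 b ->
  exists p, [/\ p \in A, 0 < c p, mass_below (height p) <= t
                & t < mass_below (height p).+1].
Proof.
move=> ta tb.
have t0 : mass_below 0 <= t.
  apply: le_trans ta; rewrite /mass_below big1 => [|p _]; last by [].
  by apply: sumr_ge0 => p _; exact: mulrn_wge0.
have exn : exists n, t < mass_below n.
  exists (\max_(p in A) height p).+1; apply: lt_le_trans tb _.
  by apply: ler_mass => p pA _; rewrite ltnS (leq_bigmax_cond _ pA).
(* The least height bound exceeding [t] is a successor [n.+1], so the jump across [t] comes from
   members of height exactly [n]. *)
case: (ex_minnP exn) => -[|n] tn nmin; first by move: tn; rewrite ltNge t0.
have tn' : mass_below n <= t.
  by rewrite leNgt; apply/negP => /nmin; rewrite ltnn.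
suff /existsP[p /and3P[pA /eqP pn cp]] :
    [exists p, [&& p \in A, height p == n & 0 < c p]].
  by exists p; rewrite pn.
apply: contraT => /existsPn nop; have := lt_le_trans tn (le_trans _ tn').
rewrite ltxx => -> //; apply: ler_sum => p pA; have := nop p.
rewrite pA /= negb_and ltnS [in X in _ -> X]leq_eqVlt => /orP[/negbTE->//|].
rewrite -leNgt => cp; have -> : c p = 0 by apply/eqP; rewrite eq_le cp c0.
by rewrite !mul0rn.
Qed.

Lemma NE_diff_mass1 a b :
  NE_diff a b (\sum_(p in A) c p *: efv p).1 = mass_out1 b - mass_out1 a.
Proof.
rewrite raddf_sum linear_sum -sumrB; apply: eq_bigr => p _ /=.
rewrite linearZ /= NE_diff_evec; case: (a \in p.1); case: (b \in p.1) => /=;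
by rewrite ?subrr ?subr0 ?sub0r ?mulr0 ?mulr1 ?mulrN1.
Qed.

Lemma NE_diff_mass2 a b :
  NE_diff a b (\sum_(p in A) c p *: efv p).2 = mass_in2 a - mass_in2 b.
Proof.
rewrite raddf_sum linear_sum -sumrB; apply: eq_bigr => p _ /=.
rewrite linearZ /= NE_diff_evec; case: (a \in p.2); case: (b \in p.2) => /=;
by rewrite ?subrr ?subr0 ?sub0r ?mulr0 ?mulr1 ?mulrN1.
Qed.

End Support.

(* [p.1] and [p.2] are the sublevel set of [mass_out1] and the strict
   superlevel set of [mass_in2] at one common threshold. The point determines
   both functions up to one common constant, fixed by the requirement that the
   minimum of [mass_in2 - mass_out1] be zero. *)
Lemma biflag_support A B c d : biflag A -> biflag B ->
  (forall p, 0 <= c p) -> (forall p, 0 <= d p) ->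
  \sum_(p in A) c p *: efv p = \sum_(p in B) d p *: efv p ->
  forall p, p \in A -> 0 < c p -> p \in B.
Proof.
move=> bA bB c0 d0 cd p pA cp.
have d1 a b : mass_out1 A c b - mass_out1 A c a = mass_out1 B d b - mass_out1 B d a.
  by rewrite -!NE_diff_mass1 cd.
have d2 a b : mass_in2 A c a - mass_in2 A c b = mass_in2 B d a - mass_in2 B d b.
  by rewrite -!NE_diff_mass2 cd.
have [e eA] := mass_balanced c bA; have [e' eB] := mass_balanced d bB.
pose s := mass_out1 A c e - mass_out1 B d e.
have s1 a : mass_out1 A c a = mass_out1 B d a + s.
  by have := d1 e a; rewrite /s => /eqP; rewrite subr_eq => /eqP->; lra.
(* Both gaps [mass_in2 - mass_out1] are nonnegative, vanish at [e] and [e'] respectively, and differ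
   by a constant; hence they coincide and the shift is again [s]. *)
have s2 a : mass_in2 A c a = mass_in2 B d a + s.
  have := d2 a e; have := d2 e e'; have := d1 e' e.
  have := mass_out1_le bA c0 e'; have := mass_out1_le bB d0 e.
  rewrite /s; lra.
have [Abi _ _] := bA; have [Bbi _ _] := bB.
have /and4P[/set0Pn[a ap] /set0Pn[b bp] _ _] := Abi _ pA.
(* The threshold at [p], moved to the normalization of [B]. *)
pose t := mass_below A c (height p) - s.
have jump := mass_below_jump c0 pA cp.
have in1 x : (x \in p.1) = (mass_out1 B d x <= t).
  apply/idP/idP => [/(mass_out1_in bA c0 pA)|]; first by rewrite s1 /t; lra.
  apply: contraTT => /(mass_out1_out bA c0 pA); rewrite s1 /t -ltNge; lra.
have in2 x : (x \in p.2) = (t < mass_in2 B d x).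
  apply/idP/idP => [/(mass_in2_in bA c0 pA)|]; first by rewrite s2 /t; lra.
  apply: contraTT => /(mass_in2_out bA c0 pA); rewrite s2 /t -leNgt; lra.
rewrite in1 in ap; rewrite in2 in bp.
have [q [qB dq tq qt]] := mass_level d0 ap bp.
suff -> : p = q by [].
rewrite [p]surjective_pairing [q]surjective_pairing; congr (_, _); apply/setP => x.
  rewrite in1; apply/idP/idP => [|/(mass_out1_in bB d0 qB)]; last by lra.
  by apply: contraTT => /(mass_out1_out bB d0 qB); rewrite -ltNge; lra.
rewrite in2; apply/idP/idP => [|/(mass_in2_in bB d0 qB)]; last by lra.
by apply: contraTT => /(mass_in2_out bB d0 qB); rewrite -leNgt; lra.
Qed.

End Biflag.

Lemma sorted_total (T : eqType) (leT : rel T) (s : seq T) :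
  reflexive leT -> transitive leT -> sorted leT s -> {in s &, total leT}.
Proof.
move=> refl tr ss x y xs ys.
have lt_index z : z \in s -> (index z s < size s)%N by rewrite index_mem.
have mono := sorted_leq_nth tr refl x ss.
case/orP: (leq_total (index x s) (index y s)) => /mono xy; apply/orP.
  by left; rewrite -(nth_index x xs) -(nth_index x ys) xy // inE lt_index.
by right; rewrite -(nth_index x xs) -(nth_index x ys) xy // inE lt_index.
Qed.

Lemma in_bigcup_seq (T : finType) (I : Type) (s : seq I) (F : I -> {set T}) x :
  (x \in \bigcup_(i <- s) F i) = has (fun i => x \in F i) s.
Proof. by elim: s => [|i s IH]; rewrite ?big_nil ?big_cons inE ?IH. Qed.

(** * Both fans as families of positive hulls; supports along chains of subsets *)

Section Fans.
Variables (R : realType) (E : finType).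
Local Notation NE := (NE R E).
Local Notation NEE := (NE * NE)%type.
Local Notation pair := ({set E} * {set E})%type.
Implicit Types (a b e : E) (p q : pair) (A B : {set pair}) (K L : {set {set E}}).
Local Notation efv := (fun p : pair => efvec R p.1 p.2).

Lemma bipermutohedral_fanE :
  bipermutohedral_fan R E = [set pos_hull efv A | A in @biflag E].
Proof.
apply/seteqP; split => sigma /=.
  move=> [s [sbi ss + ->]]; rewrite -finset.subTset => /subsetPn[e _ es].
  exists [set p in s]; last by rewrite cone_map.
  split.
  - by move=> p; rewrite inE; exact: sbi.
  - move=> p q; rewrite !inE; apply: (sorted_total _ _ ss) => [r|r p' q'].
      by rewrite !fintype.subxx.
    move=> /andP[h1 h2] /andP[h3 h4].
    by rewrite (fintype.subset_trans h1 h3) (fintype.subset_trans h4 h2).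
  - exists e => p; rewrite inE => ps.
    by move: es; rewrite in_bigcup_seq => /hasPn/(_ p ps).
move=> [A [Abi Atot [e eA]] <-].
exists (sort (@bisubset_le E) (enum A)); split.
- by move=> p; rewrite mem_sort mem_enum; exact: Abi.
- apply: (sort_sorted_in (P := mem A)); first by [].
  by apply/allP => p; rewrite mem_enum.
- rewrite -finset.subTset; apply/subsetPn; exists e => //.
  rewrite in_bigcup_seq; apply/hasPn => p.
  by rewrite mem_sort mem_enum => /eA.
- rewrite cone_map; congr pos_hull; apply/setP => p.
  by rewrite inE mem_sort mem_enum.
Qed.

Definition chain K : Prop :=
  (forall S, S \in K -> S != finset.set0 /\ S != finset.setT) /\
  {in K &, total (fun S T : {set E} => S \subset T)}.

Lemma bergman_fanE (M : matroid E) :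
  bergman_fan R M =
  [set pos_hull (@evec R E) K | K in [set K | chain K /\ forall F, F \in K -> flat M F]].
Proof.
apply/seteqP; split => sigma /=.
  move=> [s [ss sM ->]]; exists [set F in s]; last by rewrite cone_map.
  split; last by move=> F; rewrite inE => /sM[].
  split; first by move=> F; rewrite inE => /sM[].
  move=> F G; rewrite !inE; move=> Fs Gs.
  have leP : sorted (fun S T : {set E} => S \subset T) s.
    by apply: sub_sorted ss => S T; exact: fintype.proper_sub.
  apply: (sorted_total _ _ leP) => // T S U.
  exact: fintype.subset_trans.
move=> [K [[KP Ktot] KM] <-].
have tr : transitive (fun S T : {set E} => S \subset T).
  by move=> B A C; exact: fintype.subset_trans.
exists (sort (fun S T : {set E} => S \subset T) (enum K)); split.
(* Strict inclusion is split into inclusion, from sorting, and distinctness, from the absence of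
   repetitions in [enum K]. *)
- apply: pairwise_sorted.
  apply: (@sub_pairwise _ [rel S T : {set E} | (S != T) && (S \subset T)]).
    by move=> S T /=; rewrite finset.properEneq.
  rewrite pairwise_relI -uniq_pairwise sort_uniq enum_uniq /=.
  rewrite -sorted_pairwise //; apply: (sort_sorted_in (P := mem K)) => //.
  by apply/allP => F; rewrite mem_enum.
- move=> F; rewrite mem_sort mem_enum => KF; have [] := KP F KF.
  by split => //; exact: KM.
- rewrite cone_map; congr pos_hull; apply/setP => p.
  by rewrite inE mem_sort mem_enum.
Qed.

Lemma evec0 : evec R (finset.set0 : {set E}) = 0.
Proof.
rewrite /evec (_ : indic R _ = 0) ?raddf0 //.
by apply/ffunP => a; rewrite !ffunE inE.
Qed.

Lemma evecC (S : {set E}) : evec R (~: S) = - evec R S.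
Proof.
rewrite /evec -raddfN; apply/NE_piP/asboolP; exists 1; apply/ffunP => a.
by rewrite scale1r !ffunE !inE; case: (a \in S); rewrite ?opprK ?add0r ?addr0.
Qed.

Lemma evecT : evec R (finset.setT : {set E}) = 0.
Proof. by rewrite -finset.setC0 evecC evec0 oppr0. Qed.

Definition chain_biflag K : {set pair} :=
  finset (fun p => (p.1 \in K) && (p.2 == finset.setT)).

Lemma chain_biflagP e K : chain K -> biflag (chain_biflag K).
Proof.
move=> [KP Ktot]; split.
- move=> [S T]; rewrite inE /= => /andP[/KP[S0 ST] /eqP->].
  rewrite /bisubset S0 finset.setUT finset.setIT ST eqxx /= !andbT.
  by apply/set0Pn; exists e; rewrite inE.
- move=> [S T] [S' T']; rewrite !inE /= => /andP[SK /eqP->] /andP[S'K /eqP->].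
  by rewrite /bisubset_le /= !fintype.subxx !andbT; exact: Ktot.
have [->|[S0 S0K]] := set_0Vmem K.
  by exists e => p; rewrite !inE.
(* An element outside the largest member of the chain is outside all of them. *)
have [S SK Smax] := @arg_maxnP _ S0 (mem K) (fun S => #|S|) S0K.
have [_] := KP S SK; rewrite -finset.subTset => /subsetPn[a _ aS].
exists a => -[S' T']; rewrite inE /= => /andP[S'K /eqP->].
rewrite finset.setIT; apply: contra aS; apply: fintype.subsetP.
case/orP: (Ktot _ _ S'K SK) => // SS'.
suff -> : S' = S by [].
by apply/esym/eqP; rewrite eqEcard SS'; exact: Smax.
Qed.

Lemma chain_biflag_sum K (c : {set E} -> R) :
  \sum_(p in chain_biflag K) c p.1 *: efv p =
  (\sum_(S in K) c S *: evec R S, 0).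
Proof.
have inj : {in K &, injective (fun S : {set E} => (S, finset.setT) : pair)}.
  by move=> S T _ _ [].
rewrite (_ : chain_biflag K = (fun S => (S, finset.setT)) @: K)%SET.
  rewrite big_imset //= [LHS]surjective_pairing !raddf_sum; congr (_, _).
  by rewrite big1 // => S _ /=; rewrite evecT scaler0.
apply/setP => -[S T]; rewrite inE; apply/andP/imsetP => /= [[SK /eqP->]|].
  by exists S.
by move=> [S' SK [-> ->]].
Qed.

Lemma chain_support K L (c d : {set E} -> R) : chain K -> chain L ->
  (forall S, 0 <= c S) -> (forall S, 0 <= d S) ->
  \sum_(S in K) c S *: evec R S = \sum_(S in L) d S *: evec R S ->
  forall S, S \in K -> 0 < c S -> S \in L.
Proof.
move=> chK chL c0 d0 cd S SK cS.
have [_] := chK.1 S SK; rewrite -finset.subTset => /subsetPn[e _ _].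
suff : (S, finset.setT) \in chain_biflag L by rewrite inE /= => /andP[].
apply: (@biflag_support R E (chain_biflag K) _ (c \o fst) (d \o fst)) => //.
- exact: chain_biflagP.
- exact: chain_biflagP.
- by move=> p; exact: c0.
- by move=> p; exact: d0.
- by rewrite !chain_biflag_sum cd.
- by rewrite inE SK /=.
Qed.

(** Here [g] may repeat values or take the values empty and full. The latter contribute zero
    vectors; coefficients over each remaining fibre are added, giving a genuine chain [K]. *)
Lemma family_support (I : finType) (A : {set I}) (g : I -> {set E}) L
    (c : I -> R) (d : {set E} -> R) :
  {in A &, forall i j, (g i \subset g j) || (g j \subset g i)} -> chain L ->
  (forall i, 0 <= c i) -> (forall S, 0 <= d S) ->
  \sum_(i in A) c i *: evec R (g i) = \sum_(S in L) d S *: evec R S ->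
  forall i, i \in A -> 0 < c i -> g i != finset.set0 -> g i != finset.setT ->
  g i \in L.
Proof.
move=> Atot chL c0 d0 cd i iA ci gi0 giT.
pose proper_sub S := (S != finset.set0) && (S != finset.setT :> {set E}).
pose K := finset (fun S => [exists i in A, g i == S] && proper_sub S).
pose cK S := \sum_(i in A | g i == S) c i.
apply: (chain_support (K := K) (c := cK) (d := d)) => //.
- split=> [S|S T]; first by rewrite inE => /andP[_ /andP[]].
  rewrite !inE => /andP[/exists_inP[j jA /eqP<-] _].
  by move=> /andP[/exists_inP[k kA /eqP<-] _]; exact: Atot.
- by move=> S; exact: sumr_ge0.
- rewrite -cd (bigID (proper_sub \o g)) /= [X in _ + X]big1 ?addr0; last first.
    move=> j /andP[_]; rewrite negb_and !negbK => /orP[] /eqP->.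
      by rewrite evec0 scaler0.
    by rewrite evecT scaler0.
  rewrite (partition_big g (mem K)) /=; last first.
    by move=> j /andP[jA gj]; rewrite inE gj andbT; apply/exists_inP; exists j.
  apply: eq_bigr => S; rewrite inE => /andP[_ SP]; rewrite scaler_suml.
  apply: eq_big => [j|j /andP[_ /eqP->]] //.
  by case: eqP => [->|]; rewrite ?andbF // SP !andbT.
- by rewrite inE /proper_sub gi0 giT !andbT; apply/exists_inP; exists i.
- rewrite /cK (bigD1 i) ?iA ?eqxx //= ltr_pwDl // sumr_ge0 // => j.
Qed.

End Fans.

(** Each [x] lies in some basis, so adding it to the empty set raises the rank from 0. *)
Lemma flat0 (E : finType) (M : matroid E) :
  (forall x, ~~ loop M x) -> flat M finset.set0.
Proof.
move=> loopless; apply/forallP => x; apply/implyP => _.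
have := loopless x; rewrite negb_forall_in => /exists_inP[B MB /negPn xB].
apply: (@leq_trans 1).
  by rewrite ltnS /mrank; apply/bigmax_leqP => B' _; rewrite finset.set0I cards0.
apply: leq_trans (leq_bigmax_cond _ MB); rewrite card_gt0; apply/set0Pn.
by exists x; rewrite !inE eqxx.
Qed.

Lemma flatT (E : finType) (M : matroid E) : flat M finset.setT.
Proof. by apply/forallP => x; rewrite inE. Qed.

(** * Intersections, rays and smoothness in the bipermutohedral fan *)

Section BipermutohedralFan.
Variables (R : realType) (E : finType).
Local Notation NE := (NE R E).
Local Notation NEE := (NE * NE)%type.
Local Notation pair := ({set E} * {set E})%type.
Implicit Types (p q : pair) (A B : {set pair}).
Local Notation efv := (fun p : pair => efvec R p.1 p.2).

(** Of a common point written over [A], the generators with positive coefficient lie in [B] by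
    [biflag_support]. *)
Lemma pos_hullI A B : biflag A -> biflag B ->
  pos_hull efv A `&` pos_hull efv B = pos_hull efv (A :&: B).
Proof.
move=> bA bB; apply/seteqP; split => [x [[c c0 xA] [d d0 xB]]|x].
  exists c => //; rewrite xA (big_setID B) /= [X in _ + X]big1 ?addr0 // => p.
  rewrite inE => /andP[pB pA]; apply/eqP; rewrite scaler_eq0.
  have := c0 p; rewrite le_eqVlt => /predU1P[<-|cp]; first by rewrite eqxx.
  case/negP: pB; apply: (biflag_support bA bB c0 d0 _ pA cp).
  by rewrite -xA.
by move=> ABx; split; apply: pos_hullS ABx;
  [exact: finset.subsetIl | exact: finset.subsetIr].
Qed.

Lemma pos_hull_biflag_face A B :
  biflag A -> B \subset A -> face (pos_hull efv A) (pos_hull efv B).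
Proof.
by move=> /(biflag_dual_system R)[m _ mA]; apply: (pos_hull_face mA).
Qed.

Lemma efvec_neq0 p : bisubset p.1 p.2 -> efv p != 0.
Proof.
move=> /biflag1/(biflag_dual_system R)[m _ mp]; apply/eqP => p0.
have := mp p p; rewrite !inE eqxx p0 linear0 => /(_ isT isT)/eqP.
by rewrite eq_sym oner_eq0.
Qed.

Lemma pos_hull1_ray p : bisubset p.1 p.2 -> is_ray (pos_hull efv [set p]%SET).
Proof. by exists (efv p); [exact: efvec_neq0 | rewrite -(pos_hull1 efv)]. Qed.

Lemma pos_hull1_inj p q : bisubset p.1 p.2 -> bisubset q.1 q.2 ->
  pos_hull efv [set p]%SET = pos_hull efv [set q]%SET -> p = q.
Proof.
move=> bp bq pq.
have : pos_hull efv [set q]%SET (efv p).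
  by rewrite -pq; apply: pos_hull_mem; rewrite inE.
move=> [d d0 pd]; apply/set1P.
have one0 (p' : pair) : 0 <= (fun=> 1 : R) p' by exact: ler01.
apply: (biflag_support (biflag1 bp) (biflag1 bq) one0 d0); rewrite ?inE //.
by rewrite -pd big_set1 scale1r.
Qed.

Lemma cone_rays_pos_hull A : biflag A ->
  cone_rays (pos_hull efv A) = [set pos_hull efv [set p]%SET | p in [set p | p \in A]].
Proof.
move=> bA; have [Abi _ _] := bA; apply/seteqP; split => rho /=.
  move=> [/face_pos_hull[B BA ->] Bray].
  have [m _ mB] := biflag_dual_system R (biflagS BA bA).
  have [p Bp] := is_ray_pos_hull mB Bray.
  by exists p; rewrite ?Bp //; apply: (fintype.subsetP BA); rewrite Bp inE.
move=> [p pA <-]; split; last exact/pos_hull1_ray/Abi.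
by apply: pos_hull_biflag_face; rewrite // finset.sub1set.
Qed.

Lemma pos_hull_smooth A : biflag A -> smooth_cone (NEE_lattice R E) (pos_hull efv A).
Proof.
move=> bA; have [_ _ [e _]] := bA; have [m mi mA] := biflag_dual_system R bA.
have tA i : tnth (in_tuple (enum A)) i \in A by rewrite -mem_enum mem_tnth.
exists [seq efv p | p <- enum A].
have szE : size [seq efv p | p <- enum A] = size (enum A) by rewrite size_map.
have nthE (j : 'I_(size [seq efv p | p <- enum A])) :
    [seq efv p | p <- enum A]`_j = efv (tnth (in_tuple (enum A)) (cast_ord szE j)).
  pose p := tnth (in_tuple (enum A)) (cast_ord szE j).
  by rewrite (tnth_nth p) (nth_map p) // -szE.
have [|||t tP] := lattice_basis_completion (NEE_zbasis R e)
  (s := [seq efv p | p <- enum A])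
  (m := fun i => m (tnth (in_tuple (enum A)) (cast_ord szE i))).
- by move=> _ /mapP[p _ ->]; exact: efvec_lattice.
- by move=> i; exact: mi.
- move=> i j; rewrite nthE mA // (inj_eq _) ?(inj_eq (@cast_ord_inj _ _ _)) //.
  by apply/tuple_uniqP; exact: enum_uniq.
exists t; split => //; last by rewrite cone_enum.
exact: dual_system_lin_indep mA.
Qed.

Lemma pos_hull_rational A : biflag A ->
  rational_polyhedral (NEE_lattice R E) (pos_hull efv A) /\
  strongly_convex (pos_hull efv A).
Proof.
move=> bA; split; last first.
  by have [m _ mA] := biflag_dual_system R bA; exact: pos_hull_strongly_convex mA.
exists [seq efv p | p <- enum A]; last by rewrite cone_enum.
by move=> _ /mapP[p _ ->]; exact: efvec_lattice.
Qed.

(** A condition imposed on each member passes to subsets, so the family is closed under faces. *)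
Lemma biflag_fan_smooth (P : pred pair) :
  smooth_fan (NEE_lattice R E)
    [set pos_hull efv A | A in [set A | biflag A /\ forall p, p \in A -> P p]].
Proof.
split; last by move=> _ [A [bA _] <-]; exact: pos_hull_smooth.
split.
- apply: (@sub_finite_set _ _ [set pos_hull efv A | A in [set: {set pair}]]).
    by move=> _ [A _ <-]; exists A.
  exact/finite_image/finite_finset.
- by move=> _ [A [bA _] <-]; exact: pos_hull_rational.
- move=> _ tau [A [bA AP] <-] /face_pos_hull[B BA ->].
  exists B => //; split; first exact: biflagS BA bA.
  by move=> p /(fintype.subsetP BA); exact: AP.
- move=> _ _ [A [bA _] <-] [B [bB _] <-]; rewrite pos_hullI //.
  by split; apply: pos_hull_biflag_face; rewrite ?finset.subsetIl ?finset.subsetIr.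
Qed.

End BipermutohedralFan.

(** * The cones of the square conormal fan *)

Section SquareConormalFan.
Variables (R : realType) (E : finType) (M : matroid E).
Hypothesis loopless : forall x, ~~ loop M x.
Local Notation pair := ({set E} * {set E})%type.
Implicit Types (p q : pair) (A B : {set pair}).
Local Notation efv := (fun p : pair => efvec R p.1 p.2).

(** Stated for the bisubset [p], so the flat of [M] is the complement of its first entry; being a
    bisubset is left to [biflag]. *)
Definition biflat p : bool := flat M (~: p.1) && flat (dual M) p.2.

Lemma biflag_chain1 A : biflag A ->
  {in A &, forall p q, (~: p.1 \subset ~: q.1) || (~: q.1 \subset ~: p.1)}.
Proof.
move=> [_ Atot _] p q pA qA; rewrite !finset.setCS.
by case/orP: (Atot p q pA qA) => /andP[-> _]; rewrite ?orbT.
Qed.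

Lemma biflag_chain2 A : biflag A ->
  {in A &, forall p q, (p.2 \subset q.2) || (q.2 \subset p.2)}.
Proof.
move=> [_ Atot _] p q pA qA.
by case/orP: (Atot p q pA qA) => /andP[_ ->]; rewrite ?orbT.
Qed.

Lemma neg_pos_hull K x :
  (-%R @` pos_hull (@evec R E) K) x <-> pos_hull (@evec R E) K (- x).
Proof.
split => [[y Ky <-]|Kx]; first by rewrite opprK.
by exists (- x); rewrite ?opprK.
Qed.

(** Negating the first component turns each [e_S] into that of the complement of [S]. Each component
    is then a positive combination of indicators of nested sets, and [family_support] applies. *)
Lemma bergman_cone_inter (K L : {set {set E}}) A : chain K -> chain L -> biflag A ->
  ((-%R @` pos_hull (@evec R E) K) `*` pos_hull (@evec R E) L) `&` pos_hull efv A =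
  pos_hull efv (finset (fun p => [&& p \in A,
    ~: p.1 \in [set finset.set0; finset.setT] :|: K
    & p.2 \in [set finset.set0; finset.setT] :|: L])%SET).
Proof.
move=> chK chL bA; set A' := finset _.
have A'A : A' \subset A by apply/fintype.subsetP => p; rewrite inE => /and3P[].
have evec_hull (K' : {set {set E}}) S :
    S \in ([set finset.set0; finset.setT] :|: K')%SET ->
    pos_hull (@evec R E) K' (evec R S).
  rewrite !inE => /orP[/orP[]/eqP->|]; last exact: pos_hull_mem.
    by rewrite evec0; exact: pos_hull0.
  by rewrite evecT; exact: pos_hull0.
apply/seteqP; split => x; last first.
  move=> A'x; split; last exact: pos_hullS A'A _ A'x.
  split.
    apply/neg_pos_hull; move: x A'x.
    apply: (@pos_hull_min _ _ _ _ _ [set x | pos_hull (@evec R E) K (- x.1)]) => /=.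
    - by rewrite oppr0; exact: pos_hull0.
    - by move=> x y Kx Ky; rewrite opprD; exact: pos_hullD.
    - by move=> a x a0 Kx; rewrite -scalerN; exact: pos_hullZ.
    - by move=> p; rewrite inE => /and3P[_ pK _]; rewrite -evecC; exact: evec_hull.
  move: x A'x.
  apply: (@pos_hull_min _ _ _ _ _ [set x | pos_hull (@evec R E) L x.2]) => /=.
  - exact: pos_hull0.
  - by move=> x y; exact: pos_hullD.
  - by move=> a x; exact: pos_hullZ.
  - by move=> p; rewrite inE => /and3P[_ _ pL]; exact: evec_hull.
move=> [[/neg_pos_hull[d d0 x1] [d' d'0 x2]] [c c0 xE]].
exists c => //; rewrite xE (big_setID A') /= (finset.setIidPr A'A).
rewrite [X in _ + X]big1 ?addr0 // => p; rewrite inE => /andP[pA' pA].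
apply/eqP; rewrite scaler_eq0.
have := c0 p; rewrite le_eqVlt => /predU1P[<-|cp]; first by rewrite eqxx.
case/negP: pA'; rewrite inE pA /=; apply/andP; split; rewrite !inE.
  have [//|p0] := eqVneq; have [//|pT] := eqVneq; rewrite /=.
  apply: (family_support (biflag_chain1 bA) chK c0 d0 _ pA cp) => //.
  rewrite -x1 xE raddf_sum -sumrN; apply: eq_bigr => q _ /=.
  by rewrite evecC scalerN.
have [//|p0] := eqVneq; have [//|pT] := eqVneq; rewrite /=.
apply: (family_support (g := snd) (biflag_chain2 bA) chL c0 d'0 _ pA cp) => //.
by rewrite -x2 xE raddf_sum.
Qed.

Lemma square_conormal_fanE :
  square_conormal_fan R M =
  [set pos_hull efv A | A in [set A | biflag A /\ forall p, p \in A -> biflat p]].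
Proof.
rewrite /square_conormal_fan bipermutohedral_fanE !bergman_fanE.
apply/seteqP; split => [_ [_ [_ [_ [K [chK KM] <-] <-]] [_ [L [chL LM] <-] <-]]
    [_ [A bA <-] <-]|_ [A [bA AM] <-]] /=.
  rewrite bergman_cone_inter //; eexists; last by [].
  split; first by apply: biflagS bA; apply/fintype.subsetP => p; rewrite inE => /and3P[].
  have [Abi _ _] := bA.
  (* Of the extreme values, [~: p.1] full and [p.2] empty contradict nonemptiness of the entries;
     [~: p.1] empty is a flat by looplessness and [p.2] full always is. *)
  move=> p; rewrite inE => /and3P[/Abi/and4P[p1 p2 _ _] pK pL]; apply/andP; split.
    move: pK; rewrite !inE => /orP[/orP[]/eqP pE|/KM //].
      by rewrite pE; exact: flat0.
    by move: p1; rewrite -[p.1]finset.setCK pE finset.setCT eqxx.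
  move: pL; rewrite !inE => /orP[/orP[]/eqP pE|/LM //].
    by rewrite pE eqxx in p2.
  by rewrite pE; exact: flatT.
(* Conversely, the proper nonempty flats occurring in [A] form chains [K] and [L] whose Bergman
   cones cut out the whole cone of [A]. *)
pose proper_sub S := (S != finset.set0) && (S != finset.setT :> {set E}).
pose K := finset (fun S => [exists p in A, ~: p.1 == S] && proper_sub S).
pose L := finset (fun S => [exists p in A, p.2 == S] && proper_sub S).
have chK : chain K.
  split=> [S|S T]; first by rewrite inE => /andP[_ /andP[]].
  rewrite !inE => /andP[/exists_inP[p pA /eqP<-] _].
  by move=> /andP[/exists_inP[q qA /eqP<-] _]; exact: biflag_chain1 pA qA.
have chL : chain L.
  split=> [S|S T]; first by rewrite inE => /andP[_ /andP[]].
  rewrite !inE => /andP[/exists_inP[p pA /eqP<-] _].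
  by move=> /andP[/exists_inP[q qA /eqP<-] _]; exact: biflag_chain2 pA qA.
exists ((-%R @` pos_hull (@evec R E) K) `*` pos_hull (@evec R E) L).
  exists (-%R @` pos_hull (@evec R E) K).
    exists (pos_hull (@evec R E) K) => //; exists K => //; split => // F.
    by rewrite inE => /andP[/exists_inP[p /AM/andP[pM _] /eqP<-]].
  exists (pos_hull (@evec R E) L) => //; exists L => //; split => // F.
  by rewrite inE => /andP[/exists_inP[p /AM/andP[_ pM] /eqP<-]].
exists (pos_hull efv A); first by exists A.
rewrite bergman_cone_inter //; congr pos_hull; apply/setP => p; rewrite !inE.
have [pA|//] := boolP (p \in A); rewrite /= /proper_sub.
have -> : [exists q in A, ~: q.1 == ~: p.1] by apply/exists_inP; exists p.
have -> : [exists q in A, q.2 == p.2] by apply/exists_inP; exists p.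
by rewrite -!negb_or !orbN.
Qed.

End SquareConormalFan.

(** * Matching the rays with the square biflats *)

Theorem proposition4p27 (R : realType) (E : finType) (M : matroid E)
    (loopless : forall x : E, ~~ loop M x)
    (coloopless : forall x : E, ~~ coloop M x) :
  [/\ square_conormal_fan R M =
        induced_subfan (bipermutohedral_fan R E)
          (image (square_biflat M) (@square_biflat_ray R E)),
      set_bij (square_biflat M) (fan_rays (square_conormal_fan R M))
        (@square_biflat_ray R E)
    & smooth_fan (NEE_lattice R E) (square_conormal_fan R M)].
Proof.
(* This involution exchanges a pair of flats with the bisubset indexing its ray. *)
pose comp (p : {set E} * {set E}) := (~: p.1, p.2).
have compK : involutive comp by move=> [S T]; rewrite /comp /= finset.setCK.
have rayE p : square_biflat_ray R p =
    pos_hull (fun p => efvec R p.1 p.2) [set comp p]%SET.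
  by rewrite -pos_hull1.
have biflatP p : square_biflat M p <->
    biflat M (comp p) /\ bisubset (comp p).1 (comp p).2.
  rewrite /biflat /comp /= finset.setCK.
  by split=> [[-> ->]|[/andP[]]].
(* The rays of a cone are the hulls of its single generators, and each such hull determines its
   bisubset; so the inducing condition can be tested on the members of [A]. *)
have rayP A : biflag A ->
    (cone_rays (pos_hull (fun p => efvec R p.1 p.2) A) `<=`
       image (square_biflat M) (@square_biflat_ray R E)) <->
    (forall p, p \in A -> biflat M p).
  move=> bA; have [Abi _ _] := bA; rewrite cone_rays_pos_hull //; split.
    move=> AM p pA.
    have [|q /biflatP[qM qbi]] := AM (pos_hull (fun p => efvec R p.1 p.2) [set p]%SET).
      by exists p.
    rewrite rayE => /pos_hull1_inj<- //; exact: Abi.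
  move=> AM _ [p pA <-]; exists (comp p); last by rewrite rayE compK.
  by apply/biflatP; rewrite compK; split; [exact: AM | exact: Abi].
split; last by rewrite square_conormal_fanE //; exact: biflag_fan_smooth.
  rewrite square_conormal_fanE // bipermutohedral_fanE.
  apply/seteqP; split => [_ [A [bA AM] <-]|_ [[A bA <-] /(rayP _ bA) AM]].
    by split; [exists A | apply/rayP].
  by exists A.
rewrite square_conormal_fanE //; split.
- move=> p /biflatP[pM pbi]; rewrite rayE; split; last exact: pos_hull1_ray.
  exists [set comp p]%SET => //; split; first exact: biflag1.
  by move=> q; rewrite inE => /eqP->.
- move=> p q; rewrite !inE => /biflatP[_ pbi] /biflatP[_ qbi].
  by rewrite !rayE => /(pos_hull1_inj pbi qbi)/(can_inj compK).
- move=> _ [[A [bA AM] <-] Aray].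
  have [Abi _ _] := bA; have [m _ mA] := biflag_dual_system R bA.
  have [p Ap] := is_ray_pos_hull mA Aray.
  have pA : p \in A by rewrite Ap inE.
  exists (comp p); last by rewrite rayE compK Ap.
  by apply/biflatP; rewrite compK; split; [exact: AM | exact: Abi].
Qed.
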